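(* Let $\beta\in\{1,2,4\}$. Consider on $U=\{(\sigma_1,\sigma_2)\in\mathbb R^2:4\sigma_2<\sigma_1^2\}$ the system $$g_{11}-\sigma_2g_{22}=\tfrac\beta2g_2+1,\qquad 2g_{12}+\sigma_1g_{22}=0,$$ for functions $g$ that extend by continuity to $\sigma_1=\sigma_2=0$, with zero initial conditions $g(0,0)=0$ and $\frac{\partial g(\sigma_1,0)}{\partial\sigma_1}\big|_{\sigma_1=0}=0$. The solution is $$g(\sigma_1,\sigma_2)=C\,\frac{\sigma_1^2}2-(1-C)\frac2\beta\sigma_2,$$ where $C\in\mathbb R$ is arbitrary. Thus $$L(\theta)=\exp\left(C\,\frac{\sigma_1^2}2-(1-C)\frac2\beta\sigma_2\right).$$
   Context: $g_i=\partial g/\partial\sigma_i$, $g_{ij}=\partial^2g/\partial\sigma_i\partial\sigma_j$; solutions are (sufficiently smooth) functions on $U$. In the formula for $L$: $\theta$ is a $2\times2$ real symmetric ($\beta=1$), complex Hermitian ($\beta=2$) or quaternionic Hermitian ($\beta=4$) matrix, $\sigma_1=\mathrm{tr}\,\theta$, $\sigma_2=\det\theta$ (sum and product of the two real eigenvalues), and $L$ is obtained from $g$ through $g(\sigma_1(\theta),\sigma_2(\theta))=\ln L(\theta)$. *)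

(* Defs.v *)
From HB Require Import structures.
From mathcomp Require Import all_boot all_order all_algebra.
From mathcomp Require Import complex.
From mathcomp Require Import all_classical all_reals all_analysis.
From mathcomp Require Import ring.
Set Implicit Arguments.
Unset Strict Implicit.
Unset Printing Implicit Defensive.
Import Order.TTheory GRing.Theory Num.Theory.
Import numFieldNormedType.Exports.
Local Open Scope classical_set_scope.
Local Open Scope ring_scope.

(* [Quat a b c d] is the quaternion a + b i + c j + d k. *)
Record quat (R : Type) := Quat { qre : R; qi : R; qj : R; qk : R }.

Section Quaternions.
Variable R : realType.
Implicit Types x y z : quat R.

Definition quat_tuple x := (qre x, qi x, qj x, qk x).
Definition tuple_quat (t : R * R * R * R) : quat R :=
  let: (a, b, c, d) := t in Quat a b c d.
Lemma quat_tupleK : cancel quat_tuple tuple_quat. Proof. by case. Qed.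

HB.instance Definition _ := Choice.copy (quat R) (can_type quat_tupleK).

Definition addq x y :=
  Quat (qre x + qre y) (qi x + qi y) (qj x + qj y) (qk x + qk y).
Definition oppq x := Quat (- qre x) (- qi x) (- qj x) (- qk x).
Definition zeroq : quat R := Quat 0 0 0 0.
Definition oneq : quat R := Quat 1 0 0 0.
Definition mulq x y :=
  Quat (qre x * qre y - qi x * qi y - qj x * qj y - qk x * qk y)
       (qre x * qi y + qi x * qre y + qj x * qk y - qk x * qj y)
       (qre x * qj y - qi x * qk y + qj x * qre y + qk x * qi y)
       (qre x * qk y + qi x * qj y - qj x * qi y + qk x * qre y).
Definition conjq x := Quat (qre x) (- qi x) (- qj x) (- qk x).

Lemma addqA : associative addq.
Proof. by move=> x y z; congr Quat; rewrite /= addrA. Qed.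
Lemma addqC : commutative addq.
Proof. by move=> x y; congr Quat; rewrite /= addrC. Qed.
Lemma add0q : left_id zeroq addq.
Proof. by case=> *; congr Quat; rewrite /= add0r. Qed.
Lemma addNq : left_inverse zeroq oppq addq.
Proof. by case=> *; congr Quat; rewrite /= addNr. Qed.

HB.instance Definition _ :=
  GRing.isZmodule.Build (quat R) addqA addqC add0q addNq.

Lemma mulqA : associative mulq.
Proof. by move=> x y z; congr Quat => /=; ring. Qed.
Lemma mul1q : left_id oneq mulq.
Proof. by case=> *; congr Quat => /=; ring. Qed.
Lemma mulq1 : right_id oneq mulq.
Proof. by case=> *; congr Quat => /=; ring. Qed.
Lemma mulqDl : left_distributive mulq addq.
Proof. by move=> x y z; congr Quat => /=; ring. Qed.
Lemma mulqDr : right_distributive mulq addq.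
Proof. by move=> x y z; congr Quat => /=; ring. Qed.
Lemma oneq_neq0 : oneq != zeroq.
Proof. by apply/eqP => -[] /eqP; rewrite oner_eq0. Qed.

HB.instance Definition _ := GRing.Zmodule_isNzRing.Build (quat R)
  mulqA mul1q mulq1 mulqDl mulqDr oneq_neq0.
End Quaternions.

(* Entries of the matrices for beta = 1, 2, 4 (other values are not used). *)
Definition entry (R : realType) (beta : nat) : nzRingType :=
  match beta with
  | 1 => R
  | 2 => R[i]
  | _ => quat R
  end.

Definition entry_conj (R : realType) (beta : nat) :
    entry R beta -> entry R beta :=
  match beta return entry R beta -> entry R beta with
  | 1 => id
  | 2 => @conjc R
  | _ => @conjq R
  end.

Definition entry_re (R : realType) (beta : nat) : entry R beta -> R :=
  match beta return entry R beta -> R with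
  | 1 => id
  | 2 => @complex.Re R
  | _ => @qre R
  end.

Definition hermitian2 (R : realType) (beta : nat)
    (theta : 'M[entry R beta]_2) : Prop :=
  (map_mx (@entry_conj R beta) theta)^T = theta.

(* Trace and determinant of a Hermitian matrix are real. For quaternions,
   the Leibniz formula on a 2 x 2 Hermitian matrix [[a, q], [q^*, b]] gives
   a b - q q^* = a b - |q|^2, the product of the two real eigenvalues. *)
Definition sigma1 (R : realType) (beta : nat) (theta : 'M[entry R beta]_2) : R :=
  entry_re (\tr theta).
Definition sigma2 (R : realType) (beta : nat) (theta : 'M[entry R beta]_2) : R :=
  entry_re (\det theta).

Section System.
Variable R : realType.
Implicit Types (g f : R * R -> R) (p : R * R).

Definition U : set (R * R) := [set p | 4 * p.2 < p.1 ^+ 2].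

Definition e1 : R * R := (1, 0).
Definition e2 : R * R := (0, 1).
Definition partial1 f p : R := 'D_e1 f p.
Definition partial2 f p : R := 'D_e2 f p.

Definition C1_on_U f : Prop := forall p, U p ->
  [/\ derivable f p e1, derivable f p e2,
      {for p, continuous (partial1 f)} & {for p, continuous (partial2 f)}].
Definition C2_on_U f : Prop :=
  [/\ C1_on_U f, C1_on_U (partial1 f) & C1_on_U (partial2 f)].

(* Only the values of g on U are used: at a boundary point of U, and in
   particular at the origin, g is replaced by its extension by continuity. *)
Definition ext_by_continuity g p : R := lim (g @ within U (nbhs p)).

Definition solves_system (beta : nat) g : Prop := forall p, U p ->
  partial1 (partial1 g) p - p.2 * partial2 (partial2 g) p
    = beta%:R / 2 * partial2 g p + 1 /\
  2 * partial1 (partial2 g) p + p.1 * partial2 (partial2 g) p = 0.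

Definition zero_initial_conditions g : Prop :=
  [/\ cvg (g @ within U (nbhs ((0, 0) : R * R))),
      ext_by_continuity g (0, 0) = 0 &
      is_derive (0 : R) (1 : R) (fun x : R => ext_by_continuity g (x, 0)) 0].

Definition is_solution (beta : nat) g : Prop :=
  [/\ C2_on_U g, solves_system beta g & zero_initial_conditions g].

Definition log_given_by (beta : nat) (L : 'M[entry R beta]_2 -> R) g : Prop :=
  forall theta, hermitian2 theta ->
    0 < L theta /\
    ext_by_continuity g (sigma1 theta, sigma2 theta) = ln (L theta).
End System.
Arguments U {R}.

(* Main.v *)
(* In the coordinates s1 and t = s2 - s1^2 / 4 (so t < 0 on U) the second equation
   says that g_2 depends on t only, hence g = A(s1) + B(t). The first equation then
   becomes A''(s1) - t B''(t) - (1 + beta)/2 B'(t) = 1, so A'' is constant and B'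
   solves an Euler equation whose nonconstant solutions are multiples of
   (-t)^(-(1 + beta)/2). These make g diverge at the origin, so B is affine and A
   quadratic; the initial conditions remove the terms of degree 1 in s1 and 0. For
   the formula for L, the discriminant s1^2 - 4 s2 of a Hermitian matrix is
   nonnegative, so (s1, s2) lies in the closure of U. *)
Require Import Defs.
From mathcomp Require Import all_boot all_order all_algebra.
From mathcomp Require Import all_classical all_reals all_analysis.
From mathcomp Require Import perm complex ring lra.
Import Order.TTheory GRing.Theory Num.Theory.
Import numFieldNormedType.Exports.
Local Open Scope classical_set_scope.
Local Open Scope ring_scope.

(** * Mean value theorem and constancy on intervals *)

Section OneVariable.
Variable R : realType.
Implicit Types f df : R -> R.

Lemma derivable_within_segment f df (a b : R) :
  (forall x, a <= x <= b -> is_derive x 1 f (df x)) ->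
  {within `[a, b], continuous f}.
Proof.
move=> fdf; apply: derivable_within_continuous => x.
by rewrite in_itv /= => /fdf[].
Qed.

(** Balls make the statement symmetric in the order of [a] and [b]; they are also what
    neighbourhoods in the plane provide. *)
Lemma mean_value_ball f df (a b : R) :
  (forall x, `|x - a| <= `|b - a| -> is_derive x 1 f (df x)) ->
  exists2 c, `|c - a| <= `|b - a| & f b - f a = df c * (b - a).
Proof.
move=> fdf; have [leab|/ltW leba] := leP a b.
  have close x : a <= x <= b -> `|x - a| <= `|b - a|.
    by move=> /andP[ax xb]; rewrite !ger0_norm; lra.
  have [x||c cab eqc] := @MVT_segment _ f df a b leab; last 1 first.
  - by exists c => //; apply: close; rewrite in_itv in cab.
  - rewrite in_itv /= => /andP[/ltW ? /ltW ?].
    by apply: fdf; apply: close; apply/andP.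
  - by apply: derivable_within_segment => x /close /fdf.
have close x : b <= x <= a -> `|x - a| <= `|b - a|.
  by move=> /andP[bx xa]; rewrite !ler0_norm; lra.
have [x||c cab eqc] := @MVT_segment _ f df b a leba; last 1 first.
- exists c; first by apply: close; rewrite in_itv in cab.
  by rewrite -[LHS]opprB eqc -mulrN opprB.
- rewrite in_itv /= => /andP[/ltW ? /ltW ?].
  by apply: fdf; apply: close; apply/andP.
- by apply: derivable_within_segment => x /close /fdf.
Qed.

Lemma is_derive_0_interval f (i : interval R) :
  {in i, forall x, is_derive x (1 : R) f 0} -> {in i &, forall x y, f x = f y}.
Proof.
move=> df0; suff le_case x y : x \in i -> y \in i -> x <= y -> f x = f y.
  move=> x y xi yi; have [xy|/ltW yx] := leP x y; first exact: le_case.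
  by rewrite (le_case y x).
move=> xi yi xy; have sub z : x <= z <= y -> z \in i.
  by move=> zxy; apply: (interval_is_interval xi yi).
have [z||c _] := @MVT_segment _ f (fun=> 0) x y xy.
- rewrite in_itv /= => /andP[/ltW ? /ltW ?].
  by apply: df0; apply: sub; apply/andP.
- by apply: (@derivable_within_segment _ (fun=> 0)) => z /sub /df0.
- by rewrite mul0r => /eqP; rewrite subr_eq0 => /eqP.
Qed.

Lemma is_derive_translate f (d s k : R) :
  is_derive (s + k) 1 f d -> is_derive s 1 (fun t => f (t + k)) d.
Proof.
move=> df; rewrite -[d]mulr1.
exact: (@is_derive1_comp _ f (fun t => t + k) s d 1 df (is_derive_shift s 1 k)).
Qed.

End OneVariable.

(** * Partial derivatives and the chain rule along a graph *)

Section Partials.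
Variable R : realType.
Implicit Types (f g : R * R -> R) (p : R * R).

Lemma is_derive_slice1 f (x y d : R) :
  is_derive (x, y) (@e1 R) f d <-> is_derive x 1 (fun t => f (t, y)) d.
Proof.
have E : (fun h : R => h^-1 *: ((f \o shift (x, y)) (h *: @e1 R) - f (x, y)))
    = (fun h : R => h^-1 *: (((fun t => f (t, y)) \o shift x) (h *: (1 : R))
                             - f (x, y))).
  apply/funext => h /=; congr (_ *: (f _ - _)).
  by congr pair; rewrite /= ?scaler0 ?add0r.
by split=> -[df dE]; split;
  [rewrite /derivable -E | rewrite /derive -E | rewrite /derivable E
  | rewrite /derive E].
Qed.

Lemma is_derive_slice2 f (x y d : R) :
  is_derive (x, y) (@e2 R) f d <-> is_derive y 1 (fun t => f (x, t)) d.
Proof.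
have E : (fun h : R => h^-1 *: ((f \o shift (x, y)) (h *: @e2 R) - f (x, y)))
    = (fun h : R => h^-1 *: (((fun t => f (x, t)) \o shift y) (h *: (1 : R))
                             - f (x, y))).
  apply/funext => h /=; congr (_ *: (f _ - _)).
  by congr pair; rewrite /= ?scaler0 ?add0r.
by split=> -[df dE]; split;
  [rewrite /derivable -E | rewrite /derive -E | rewrite /derivable E
  | rewrite /derive E].
Qed.

(* f (x, v x) is the sum of F1 x = f (x, v x) - f (x0, v x), handled by the mean
   value theorem in the first variable, and of f (x0, v x). *)
Lemma is_derive_graph f (v : R -> R) (x0 dv : R) :
  (\forall p \near (x0, v x0), derivable f p (@e1 R)) ->
  derivable f (x0, v x0) (@e2 R) ->
  {for (x0, v x0), continuous (partial1 f)} ->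
  is_derive x0 1 v dv ->
  is_derive x0 1 (fun x => f (x, v x))
    (partial1 f (x0, v x0) + partial2 f (x0, v x0) * dv).
Proof.
move=> df1 df2 cf1 dvx0.
pose F1 x := f (x, v x) - f (x0, v x).
have -> : (fun x => f (x, v x)) = F1 + ((fun t => f (x0, t)) \o v).
  by apply/funext => x; rewrite /F1 /= !fctE /= subrK.
have d2 : is_derive (v x0) 1 (fun t => f (x0, t)) (partial2 f (x0, v x0)).
  exact/is_derive_slice2/derivableP.
apply: is_deriveD.
have cv : {for x0, continuous v}.
  by apply/differentiable_continuous/derivable1_diffP; exact: ex_derive.
set d := partial1 f (x0, v x0).
(* Carathéodory's criterion: [F1] vanishes at [x0], and its difference quotient, given the value [d]
   there, has to be continuous at [x0]. *)
apply/is_derive1_caratheodory.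
exists (fun z => if z == x0 then d else F1 z / (z - x0)); split; last by rewrite eqxx.
- move=> z; rewrite {2}/F1 subrr subr0; case: eqVneq => [->|zx].
    by rewrite /F1 !subrr mulr0.
  by rewrite divfK// subr_eq0.
- rewrite /prop_for /continuous_at eqxx; apply/cvgrPdist_lt => e e0.
  have near_p : \forall p \near (x0, v x0),
      derivable f p (@e1 R) /\ `|d - partial1 f p| < e.
    by near=> p; split; near: p => //; move/cvgrPdist_lt : cf1; apply.
  have [r r0 rP] := (nbhs_ballP _ _).1 near_p.
  have near_z : \forall z \near x0, `|x0 - z| < r /\ `|v x0 - v z| < r.
    near=> z; split; near: z.
      by apply: (cvgrPdist_lt _ _).1 => //; exact: cvg_id.
    by move/cvgrPdist_lt : cv; apply.
  apply: filterS near_z => z [zr vzr].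
  case: eqVneq => [_|zx0]; first by rewrite subrr normr0.
  (* The segment from [x0] to [z] at height [v z] stays in the ball, so the mean value theorem
     applies on it. *)
  have inball x : `|x - x0| <= `|z - x0| -> ball (x0, v x0) r (x, v z).
    move=> xz; split; rewrite /ball /= //.
    by rewrite distrC (le_lt_trans xz)// distrC.
  have [x xz|c cz] := @mean_value_ball R (fun t => f (t, v z))
    (fun t => partial1 f (t, v z)) x0 z.
    by apply/is_derive_slice1/derivableP; have [] := rP _ (inball _ xz).
  rewrite -/(F1 z) => ->; rewrite mulfK ?subr_eq0//.
  by have [] := rP _ (inball _ cz).
Unshelve. all: by end_near. Qed.

End Partials.

(** * Quadratic polynomials in one variable *)

Lemma is_derive_quad (R : realType) (p q r x : R) :
  is_derive x 1 (fun t => p * t ^+ 2 + q * t + r) (2 * p * x + q).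
Proof.
have -> : (fun t => p * t ^+ 2 + q * t + r)
    = p \*: (id ^+ 2) + q \*: id + cst r.
  by apply/funext => t; rewrite !fctE.
by apply: is_derive_eq; rewrite /GRing.scale /=; ring.
Qed.

Lemma near_gt_quad (R : realType) (p q r x : R) :
  0 < p * x ^+ 2 + q * x + r ->
  \forall t \near x, 0 < p * t ^+ 2 + q * t + r.
Proof.
move=> pos; have [dq _] := is_derive_quad R p q r x.
have /cvgr_gt := differentiable_continuous ((derivable1_diffP _ _).1 dq).
exact.
Qed.

(** * The domain [U], limits within it, and quadratic polynomials on it *)

Section Domain.
Variable R : realType.
Implicit Types (g f : R * R -> R) (p : R * R).

(** All solutions turn out to be of this shape on [U]; the discriminant s1^2 - 4 s2 is another
    instance. *)
Lemma continuous_quad (A D F G : R) :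
  continuous (fun p : R * R => A * p.1 ^+ 2 + D * p.1 + F * p.2 + G).
Proof.
move=> p; have c1 : {for p, continuous (fst : R * R -> R)} by exact: cvg_fst.
have c2 : {for p, continuous (snd : R * R -> R)} by exact: cvg_snd.
apply: cvgD; last exact: cvg_cst.
apply: cvgD; last by apply: cvgM => //; exact: cvg_cst.
apply: cvgD; last by apply: cvgM => //; exact: cvg_cst.
apply: cvgM; first exact: cvg_cst.
by under eq_fun do rewrite expr2; rewrite expr2; exact: cvgM.
Qed.

Lemma U_near p : U p -> \forall q \near p, U q.
Proof.
rewrite /U /= => Up.
have /cvgr_gt H := continuous_quad 1 0 (-4) 0 p.
have {H} : \forall q \near p, 0 < 1 * q.1 ^+ 2 + 0 * q.1 + -4 * q.2 + 0.
  by apply: H; lra.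
by apply: filterS => q /=; lra.
Qed.

Lemma U_closure_proper p : 4 * p.2 <= p.1 ^+ 2 ->
  ProperFilter (within U (nbhs p)).
Proof.
move=> Up; apply: within_nbhs_proper => /=.
(* Lowering the second coordinate enters [U], even from a boundary point. *)
move=> N /nbhs_ballP[r /= r0 rN]; exists (p.1, p.2 - r / 2); split.
  by rewrite /U /=; lra.
apply: rN; split => /=; first exact: ballxx.
by rewrite /ball /= opprB addrC subrK gtr0_norm; lra.
Qed.

Lemma ext_by_continuity_cvg f g p : 4 * p.2 <= p.1 ^+ 2 ->
  {in U, f =1 g} -> {for p, continuous g} ->
  f @ within U (nbhs p) --> g p.
Proof.
move=> Up fg cg; apply: cvg_trans (cvg_within_filter _ cg).
apply: near_eq_cvg; apply: filterS (withinT _ _) => // q Uq.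
by rewrite fg ?inE.
Qed.

(** Limits within [U] see only values on [U], and they are unique at every point of its closure. *)
Lemma ext_by_continuityE f g p : 4 * p.2 <= p.1 ^+ 2 ->
  {in U, f =1 g} -> {for p, continuous g} ->
  ext_by_continuity f p = g p.
Proof.
move=> Up fg cg; apply: cvg_lim => //; last exact: ext_by_continuity_cvg.
exact: U_closure_proper.
Qed.

Lemma is_derive_on_U f g p v d : {in U, f =1 g} -> U p ->
  is_derive p v g d -> is_derive p v f d.
Proof.
move=> fg Up; apply: near_eq_is_derive; apply: filterS (U_near _ Up) => q Uq.
by rewrite fg ?inE.
Qed.

Lemma is_derive_quad1 (A D F G : R) p :
  is_derive p (@e1 R) (fun p : R * R => A * p.1 ^+ 2 + D * p.1 + F * p.2 + G)
    (2 * A * p.1 + D).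
Proof.
case: p => x y; apply/is_derive_slice1 => /=.
by under eq_fun do rewrite -addrA; exact: is_derive_quad.
Qed.

Lemma is_derive_quad2 (A D F G : R) p :
  is_derive p (@e2 R) (fun p : R * R => A * p.1 ^+ 2 + D * p.1 + F * p.2 + G) F.
Proof.
case: p => x y; apply/is_derive_slice2 => /=.
have -> : (fun t => A * x ^+ 2 + D * x + F * t + G)
    = fun t => 0 * t ^+ 2 + F * t + (A * x ^+ 2 + D * x + G).
  by apply/funext => t; ring.
by apply: is_derive_eq (is_derive_quad _ _ _ _ _) _; ring.
Qed.

(* The partial derivatives are written as quadratic polynomials again, so that the
   lemma applies to them in turn. *)
Lemma quad_on_U f (A D F G : R) :
  {in U, f =1 fun p => A * p.1 ^+ 2 + D * p.1 + F * p.2 + G} ->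
  [/\ C1_on_U f,
      {in U, partial1 f =1 fun p => 0 * p.1 ^+ 2 + (2 * A) * p.1 + 0 * p.2 + D} &
      {in U, partial2 f =1 fun p => 0 * p.1 ^+ 2 + 0 * p.1 + 0 * p.2 + F}].
Proof.
move=> fq.
have d1 p (Up : U p) := is_derive_on_U _ _ _ _ _ fq Up (is_derive_quad1 A D F G p).
have d2 p (Up : U p) := is_derive_on_U _ _ _ _ _ fq Up (is_derive_quad2 A D F G p).
have E1 : {in U, partial1 f =1 fun p => 0 * p.1 ^+ 2 + (2 * A) * p.1 + 0 * p.2 + D}.
  by move=> p; rewrite inE => /d1[_]; rewrite /partial1 => ->; ring.
have E2 : {in U, partial2 f =1 fun p => 0 * p.1 ^+ 2 + 0 * p.1 + 0 * p.2 + F}.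
  by move=> p; rewrite inE => /d2[_]; rewrite /partial2 => ->; ring.
have cont h (k : R * R -> R) p : {in U, h =1 k} -> U p -> continuous k ->
    {for p, continuous h}.
  move=> hk Up ck; rewrite /prop_for /continuous_at (hk _ (mem_set Up)).
  apply: cvg_trans (ck p); apply: near_eq_cvg.
  by apply: filterS (U_near _ Up) => q Uq; rewrite hk ?inE.
split=> // p Up; split; first by case: (d1 _ Up).
- by case: (d2 _ Up).
- exact: cont E1 Up (continuous_quad _ _ _ _).
- exact: cont E2 Up (continuous_quad _ _ _ _).
Qed.

End Domain.

(** * Separation of variables for a solution *)

Section Uniqueness.
Variables (R : realType) (beta : nat) (g : R * R -> R).
Hypothesis beta_gt0 : (0 < beta)%N.
Hypotheses (gC2 : C2_on_U g) (gS : solves_system beta g).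
Hypothesis g_cvg : cvg (g @ within U (nbhs ((0, 0) : R * R))).

Let b : R := beta%:R.
(** On the axis s1 = 0 the coordinate t is s2, so [B] is one half of the splitting, and [B1], [B2]
    are its derivatives for t < 0. *)
Let B (t : R) := g (0, t).
Let B1 (t : R) := partial2 g (0, t).
Let B2 (t : R) := partial2 (partial2 g) (0, t).

Let slices (f : R * R -> R) (x y : R) : C1_on_U f -> U (x, y) ->
  is_derive x 1 (fun t => f (t, y)) (partial1 f (x, y)) /\
  is_derive y 1 (fun t => f (x, t)) (partial2 f (x, y)).
Proof.
move=> fC1 /fC1[/derivableP d1 /derivableP d2 _ _].
by split; [exact/is_derive_slice1 | exact/is_derive_slice2].
Qed.

Let U0 (t : R) : t < 0 -> U (0, t).
Proof. by move=> ?; rewrite /U /= expr0n /=; lra. Qed.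

Let dB (t : R) : t < 0 -> is_derive t 1 B (B1 t).
Proof. by case: gC2 => gC1 _ _ /U0 U0t; have [] := slices g 0 t gC1 U0t. Qed.

Let dB1 (t : R) : t < 0 -> is_derive t 1 B1 (B2 t).
Proof. by case: gC2 => _ _ gC1 /U0 U0t; have [] := slices _ 0 t gC1 U0t. Qed.

(* The second equation is the vanishing of the derivative of partial2 g along the
   parabolas s2 - s1^2 / 4 = t. *)
Lemma partial2_solution (x y : R) : U (x, y) ->
  partial2 g (x, y) = B1 (y - 4^-1 * x ^+ 2).
Proof.
rewrite /U /= => Uxy; pose t := y - 4^-1 * x ^+ 2.
(* The parabola through (x, y) on which t is constant; it meets the axis s1 = 0 at (0, t). *)
pose v s : R := 4^-1 * s ^+ 2 + 0 * s + t.
have Uv (s : R) : U (s, v s) by rewrite /U /= /v /t; lra.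
have [_ _ g2C1] := gC2.
have dv (s : R) : is_derive s 1 (fun s => partial2 g (s, v s)) 0.
  (* The slope of [v] is s/2, so the derivative is half of the left side of the second equation. *)
  have -> : 0 = partial1 (partial2 g) (s, v s)
      + partial2 (partial2 g) (s, v s) * (2 * 4^-1 * s + 0).
    by have [_ /=] := gS _ (Uv s); lra.
  have [d1 d2 c1 _] := g2C1 _ (Uv s).
  have d1n : \forall p \near (s, v s), derivable (partial2 g) p (@e1 R).
    by apply: filterS (U_near _ _ (Uv s)) => q /g2C1[].
  exact: (is_derive_graph _ (partial2 g) v s _ d1n d2 c1 (is_derive_quad _ _ _ _ _)).
have /(_ x 0) := fun x y => is_derive_0_is_cst x y dv.
have -> : v x = y by rewrite /v /t; lra.
by rewrite /v /t expr0n !mulr0 !add0r.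
Qed.

(** For fixed [x], both sides are values of g (x, s + x^2/4) - B s, whose derivative in [s] vanishes
    by [partial2_solution]. *)
Lemma solution_split (x y t : R) : U (x, y) -> t < 0 ->
  g (x, y) - B (y - 4^-1 * x ^+ 2) = g (x, t + 4^-1 * x ^+ 2) - B t.
Proof.
rewrite /U /= => Uxy t0; have [gC1 _ _] := gC2.
pose h (s : R) := g (x, s + 4^-1 * x ^+ 2) - B s.
have dh : {in `]-oo, (0:R)[, forall s : R, is_derive s 1 h 0}.
  move=> s; rewrite in_itv /= => s0.
  have Us : U (x, s + 4^-1 * x ^+ 2) by rewrite /U /=; lra.
  have [_ dg] := slices g _ _ gC1 Us.
  rewrite (partial2_solution _ _ Us) addrK in dg.
  have dgs := is_derive_translate R (fun y => g (x, y)) (B1 s) s _ dg.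
  rewrite -(subrr (B1 s)); have dBs := dB _ s0.
  exact: (is_deriveB dgs dBs).
have := is_derive_0_interval _ _ _ dh (y - 4^-1 * x ^+ 2) t.
rewrite /h subrK; apply; rewrite in_itv /=; lra.
Qed.

(** [A] takes t = -1 as reference; [A1] is its derivative by the chain rule, since [partial2 g] is
    [B1 (-1)] on that parabola. *)
Let A (x : R) := g (x, -1 + 4^-1 * x ^+ 2) - B (-1).
Let A1 (x : R) := partial1 g (x, -1 + 4^-1 * x ^+ 2) + x / 2 * B1 (-1).

Lemma solutionE (x y : R) : U (x, y) -> g (x, y) = A x + B (y - 4^-1 * x ^+ 2).
Proof. by move=> Uxy; rewrite /A -(solution_split x y)// ?subrK//; lra. Qed.

Let near_line (x y : R) : U (x, y) -> \forall s \near x, U (s, y).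
Proof.
rewrite /U /= => Uxy.
have : 0 < 1 * x ^+ 2 + 0 * x + - (4 * y) by lra.
by move=> /near_gt_quad; apply: filterS => s; lra.
Qed.

Let d_shear (h h1 : R -> R) (x y : R) :
  is_derive (y - 4^-1 * x ^+ 2) 1 h (h1 (y - 4^-1 * x ^+ 2)) ->
  is_derive x 1 (fun s => h (y - 4^-1 * s ^+ 2))
    (- (x / 2) * h1 (y - 4^-1 * x ^+ 2)).
Proof.
have E : (fun s => y - 4^-1 * s ^+ 2) = fun s => - 4^-1 * s ^+ 2 + 0 * s + y.
  by apply/funext => s; ring.
move=> dh; have dq : is_derive x 1 (fun s => y - 4^-1 * s ^+ 2) (- (x / 2)).
  by rewrite E; apply: is_derive_eq (is_derive_quad _ _ _ _ _) _; lra.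
by rewrite mulrC; exact: (@is_derive1_comp _ h (fun s => y - 4^-1 * s ^+ 2)).
Qed.

(** Near [x] and with [y] fixed, [A] is g (s, y) - B (y - s^2/4), so differentiation along a
    horizontal line suffices. *)
Let dA_line (x y : R) : U (x, y) ->
  is_derive x 1 A (partial1 g (x, y) + x / 2 * B1 (y - 4^-1 * x ^+ 2)).
Proof.
move=> Uxy; have [gC1 _ _] := gC2; have [d1 _] := slices _ _ _ gC1 Uxy.
have t0 : y - 4^-1 * x ^+ 2 < 0 by move: Uxy; rewrite /U /=; lra.
have dA : is_derive x 1 ((fun s => g (s, y)) - (fun s => B (y - 4^-1 * s ^+ 2)))
    (partial1 g (x, y) + x / 2 * B1 (y - 4^-1 * x ^+ 2)).
  have dBs := d_shear B B1 x y (dB _ t0).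
  have dg := is_deriveB d1 dBs.
  by rewrite mulNr opprK in dg.
apply: near_eq_is_derive dA; apply: filterS (near_line _ _ Uxy) => s Us.
by rewrite !fctE (solutionE s y Us) addrK.
Qed.

Let U_par (x t : R) : t < 0 -> U (x, t + 4^-1 * x ^+ 2).
Proof. by rewrite /U /=; lra. Qed.

Let dA (x : R) : is_derive x 1 A (A1 x).
Proof.
have Ux : U (x, -1 + 4^-1 * x ^+ 2) by apply: U_par; lra.
have := dA_line _ _ Ux.
by rewrite addrK.
Qed.

(** The derivative of [A] at [x] can be read off on every horizontal line that meets [U] at abscissa
    [x]. *)
Let A1E (x y : R) : U (x, y) ->
  A1 x = partial1 g (x, y) + x / 2 * B1 (y - 4^-1 * x ^+ 2).
Proof. by move=> /dA_line[_ <-]; case: (dA x). Qed.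

Let partial22E (x y : R) : U (x, y) ->
  partial2 (partial2 g) (x, y) = B2 (y - 4^-1 * x ^+ 2).
Proof.
move=> Uxy; have [_ _ g2C1] := gC2; have [_ [_ <-]] := slices _ _ _ g2C1 Uxy.
have t0 : y - 4^-1 * x ^+ 2 < 0 by move: Uxy; rewrite /U /=; lra.
have dc := is_derive_translate _ _ _ _ _ (dB1 _ t0).
have [|_ ->//] := near_eq_is_derive _ dc (g := fun s => partial2 g (x, s)).
have /near_gt_quad : 0 < 0 * y ^+ 2 + - 4 * y + x ^+ 2.
  by move: Uxy; rewrite /U /=; lra.
apply: filterS => s Us; rewrite /= partial2_solution//.
by rewrite /U /=; lra.
Qed.

(** Differentiating [A1E] at fixed s2 gives g11 + B1/2 - (x^2/4) B2; in the first equation s2 = t +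
    x^2/4, and the terms in x^2 cancel. *)
Let dA1 (x t : R) : t < 0 ->
  is_derive x 1 A1 (1 + (1 + b) / 2 * B1 t + t * B2 t).
Proof.
move=> t0; have [_ g1C1 _] := gC2.
have Uxy := U_par x t t0; have [d11 _] := slices _ _ _ g1C1 Uxy.
set y := t + 4^-1 * x ^+ 2 in Uxy d11 *.
have tE : t = y - 4^-1 * x ^+ 2 by rewrite /y addrK.
have dB1s := d_shear B1 B2 x y.
rewrite -tE in dB1s; have {}dB1s := dB1s (dB1 _ t0).
have dhalf : is_derive x 1 (fun s : R => s / 2) 2^-1.
  have -> : (fun s : R => s / 2) = fun s => 0 * s ^+ 2 + 2^-1 * s + 0.
    by apply/funext => s; ring.
  by apply: is_derive_eq (is_derive_quad _ _ _ _ _) _; lra.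
have dA1 : is_derive x 1 ((fun s => partial1 g (s, y)) +
    (fun s => s / 2) * (fun s => B1 (y - 4^-1 * s ^+ 2)))
    (1 + (1 + b) / 2 * B1 t + t * B2 t).
  apply: is_derive_eq (is_deriveD d11 (is_deriveM dhalf dB1s)) _.
  rewrite /GRing.scale /=.
  have [/= + _] := gS _ Uxy; rewrite partial22E// partial2_solution// -/b -tE.
  by rewrite tE /=; lra.
apply: near_eq_is_derive dA1; apply: filterS (near_line _ _ Uxy) => s Us.
by rewrite !fctE -A1E.
Qed.

(** The derivative of [A1] at a point does not depend on [t], so the Euler expression is a constant,
    evaluated at t = -1. *)
Let separation : exists2 m : R,
  forall t, t < 0 -> (1 + b) / 2 * B1 t + t * B2 t = m &
  forall x : R, is_derive x 1 A1 (1 + m).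
Proof.
have neg1 : (-1 : R) < 0 by lra.
exists ((1 + b) / 2 * B1 (-1) + -1 * B2 (-1)) => [t t0|x].
  have [_ E1] := dA1 0 t t0.
  have [_ E2] := dA1 0 (-1) neg1.
  have {E1 E2} := etrans (esym E1) E2.
  by move: (B1 t) (B2 t) (B1 (-1)) (B2 (-1)) ((1 + b) / 2) => *; lra.
have := dA1 x (-1) neg1.
by rewrite -addrA.
Qed.

(* The first equation separates into A'' = 1 + m and the Euler equation
   t B'' + (1 + beta)/2 B' = m, with stationary value c. With w = sqrt (-t), the
   quantity w^(1+beta) (B' t - c) is a constant K, so B(-w^2) + c w^2 has
   derivative -2 K w^(-beta). Since beta >= 1, its increment on [w, 2w] is at
   least |K| for small w, which contradicts the convergence of g at the origin
   unless K = 0. *)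
Lemma partial2_axis_cst : exists2 c : R,
  forall t, t < 0 -> B1 t = c & forall x : R, is_derive x 1 A1 (1 + (1 + b) / 2 * c).
Proof.
have [m mE dm] := separation.
have b_ge1 : 1 <= b by rewrite /b ler1n.
pose c := m * 2 / (1 + b).
have cE : (1 + b) / 2 * c = m.
  by rewrite /c; field; rewrite gt_eqF//; lra.
exists c; last by rewrite cE.
have sq_lt0 (w : R) : 0 < w -> - w ^+ 2 < 0.
  by move=> w0; rewrite oppr_lt0 exprn_gt0.
have dsq (h : R -> R) (d w : R) : is_derive (- w ^+ 2) 1 h d ->
    is_derive w 1 (fun w => h (- w ^+ 2)) (- (2 * w * d)).
  move=> dh; have dq : is_derive w 1 (fun w : R => - w ^+ 2) (- (2 * w)).
    have -> : (fun w : R => - w ^+ 2) = fun w => -1 * w ^+ 2 + 0 * w + 0.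
      by apply/funext => s; ring.
    by apply: is_derive_eq (is_derive_quad _ _ _ _ _) _; ring.
  rewrite -mulNr mulrC.
  exact: (@is_derive1_comp _ h (fun w => - w ^+ 2)).
pose psi (w : R) := w ^+ beta.+1 * (B1 (- w ^+ 2) - c).
pose K := psi 1.
have psiE (w : R) : 0 < w -> psi w = K.
  move=> w0.
  have dpsi : {in `]0, +oo[, forall w : R, is_derive w 1 psi 0}.
    move=> {w0}w; rewrite in_itv /= andbT => w0.
    have dw := dsq B1 _ _ (dB1 _ (sq_lt0 _ w0)).
    have -> : psi = (id ^+ beta.+1) * ((fun w => B1 (- w ^+ 2)) - cst c).
      by apply/funext => v; rewrite !fctE.
    apply: is_derive_eq; rewrite /GRing.scale /= !fctE /= mulr1 subr0.
    have := mE _ (sq_lt0 _ w0); rewrite -cE.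
    move: (B1 (- w ^+ 2)) (B2 (- w ^+ 2)) => u v E.
    rewrite -[beta.+1%:R]natr1 -/b [w ^+ beta.+1]exprS.
    (* The derivative of [psi] is 2 w^beta times the defect in the Euler equation at t = -w^2. *)
    have -> : (w * w ^+ beta) * - (2 * w * v) + (u - c) * ((b + 1) * w ^+ beta)
        = w ^+ beta * 2 * ((1 + b) / 2 * u + - w ^+ 2 * v - (1 + b) / 2 * c).
      by field.
    by rewrite E subrr mulr0.
  by apply: (is_derive_0_interval _ _ _ dpsi); rewrite in_itv /= ?w0 ?ltr01.
suff K0 : K = 0.
  move=> t t0; pose w := Num.sqrt (- t).
  have w0 : 0 < w by rewrite sqrtr_gt0 oppr_gt0.
  have := psiE _ w0; rewrite K0 /psi sqr_sqrtr; last by rewrite oppr_ge0 ltW.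
  rewrite opprK => /eqP; rewrite mulf_eq0 expf_eq0 (gt_eqF w0) andbF /=.
  by rewrite subr_eq0 => /eqP.
apply/eqP; rewrite -normr_le0 leNgt; apply/negP => K0.
(* At (0, -w^2) the function [k] is B (-w^2) + c w^2; it has a limit at the origin because [g] has
   one. *)
pose k q := g q + (- c) * q.2.
have [l kl] : exists l : R, k @ within U (nbhs ((0, 0) : R * R)) --> l.
  exists (lim (g @ within U (nbhs ((0, 0) : R * R))) + (- c) * 0).
  apply: cvgD => //; apply: cvgM; first exact: cvg_cst.
  by apply: cvg_within_filter; exact: cvg_snd.
have K2 : 0 < `|K| / 2 by rewrite divr_gt0.
have /cvgrPdist_lt/(_ _ K2)/nbhs_ballP[r /= r0 rk] := kl.
(* For 0 < v <= 2 w, the bound 2 w <= 1 gives v^beta <= v and v^2 <= v; then 4 w <= r keeps (0,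
   -v^2) in the ball. *)
have [w [w0 w1 wr]] : exists w : R, [/\ 0 < w, 2 * w <= 1 & 4 * w <= r].
  have [?|?] := leP r 1; first by exists (r / 4); split; lra.
  by exists (4^-1); split; lra.
have near_l (v : R) : 0 < v -> v <= 2 * w -> `|l - k (0, - v ^+ 2)| < `|K| / 2.
  move=> v0 vw; apply: rk; last exact/U0/sq_lt0.
  split; first exact: ballxx.
  rewrite /ball /= sub0r opprK ger0_norm ?sqr_ge0//.
  by have : v * v <= v * 1 by [rewrite ler_pM2l//; lra]; rewrite expr2; lra.
have dk (v : R) : w <= v <= 2 * w ->
    is_derive v 1 (fun v => k (0, - v ^+ 2)) (- (2 * v * (B1 (- v ^+ 2) - c))).
  move=> /andP[wv _]; have v0 : 0 < v by exact: lt_le_trans wv.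
  have dt : is_derive (- v ^+ 2) 1 (B + (- c) \*: id) (B1 (- v ^+ 2) - c).
    have dBv := dB _ (sq_lt0 _ v0).
    apply: is_derive_eq (is_deriveD dBv (is_deriveZ (- c) (is_derive_id _ _))) _.
    by rewrite /GRing.scale /= mulr1.
  exact: dsq dt.
have w2w : w <= 2 * w by lra.
have [v||v] := @MVT_segment R (fun v => k (0, - v ^+ 2))
  (fun v => - (2 * v * (B1 (- v ^+ 2) - c))) _ _ w2w.
- by rewrite in_itv /= => /andP[/ltW wv /ltW vw]; apply: dk; apply/andP.
- exact: derivable_within_segment dk.
rewrite in_itv /= => /andP[wv vw] eqk.
have v0 : 0 < v by exact: lt_le_trans wv.
have lt1 := near_l w w0 w2w.
have lt2 : `|l - k (0, - (2 * w) ^+ 2)| < `|K| / 2 by apply: near_l; lra.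
have : `|k (0, - (2 * w) ^+ 2) - k (0, - w ^+ 2)| < `|K|.
  rewrite (_ : _ - _ = (l - k (0, - w ^+ 2)) - (l - k (0, - (2 * w) ^+ 2))); last by ring.
  by rewrite (le_lt_trans (ler_normB _ _))//; lra.
rewrite eqk ltNge => /negP; apply.
rewrite -(psiE _ v0) /psi !normrM normrN !normrM.
set z := `|B1 _ - c|; have z0 : 0 <= z by exact: normr_ge0.
(* The increment has modulus 2 v w z >= v^(beta+1) z = |K|, because v^beta <= v <= 2 w. *)
have vb : v ^+ beta.+1 <= v * (2 * w).
  rewrite exprS ler_pM2l// -(prednK beta_gt0) exprS.
  apply: (le_trans _ vw); rewrite ger_pMr// exprn_ile1//; first exact: ltW.
  exact: (le_trans vw w1).
have vp0 : 0 <= v ^+ beta.+1 by rewrite exprn_ge0// ltW.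
rewrite (ger0_norm vp0) (ger0_norm (ltW v0)) (@ger0_norm _ 2)// ger0_norm; last by lra.
have -> : 2 * v * z * (2 * w - w) = v * (2 * w) * z by ring.
exact: ler_wpM2r.
Qed.

(** [A] is quadratic and [B] is affine with slope [c]; substituting t = s2 - s1^2/4 produces the
    term - c/4. *)
Lemma solution_quad : exists c d e : R,
  {in U, g =1 fun p => ((1 + (1 + b) / 2 * c) / 2 - c / 4) * p.1 ^+ 2
                       + d * p.1 + c * p.2 + e}.
Proof.
have [c B1c dA1c] := partial2_axis_cst.
set m := 1 + _ in dA1c *.
have A1E' x : A1 x = m * x + A1 0.
  pose q x : R := 0 * x ^+ 2 + m * x + 0.
  have dq (s : R) : is_derive s 1 (A1 - q) 0.
    apply: is_derive_eq (is_deriveB (dA1c s) (is_derive_quad R 0 m 0 s)) _.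
    by rewrite mulr0 mul0r add0r subrr.
  by have := is_derive_0_is_cst x 0 dq; rewrite !fctE /q; lra.
have AE x : A x = m / 2 * x ^+ 2 + A1 0 * x + A 0.
  pose q x : R := m / 2 * x ^+ 2 + A1 0 * x + 0.
  have dq (s : R) : is_derive s 1 (A - q) 0.
    apply: is_derive_eq (is_deriveB (dA s) (is_derive_quad R _ (A1 0) 0 s)) _.
    by rewrite A1E'; field.
  by have := is_derive_0_is_cst x 0 dq; rewrite !fctE /q expr0n /=; lra.
have BE t : t < 0 -> B t = c * t + (B (-1) + c).
  move=> t0; pose q x : R := 0 * x ^+ 2 + c * x + 0.
  have dq : {in `]-oo, 0[, forall s : R, is_derive s 1 (B - q) 0}.
    move=> s; rewrite in_itv /= => s0.
    apply: is_derive_eq (is_deriveB (dB s s0) (is_derive_quad R 0 c 0 s)) _.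
    by rewrite (B1c s s0) mulr0 mul0r add0r subrr.
  have := is_derive_0_interval _ _ _ dq t (-1).
  have n1 : (-1 : R) < 0 by lra.
  by rewrite !in_itv /= !fctE /q => /(_ t0 n1); lra.
exists c, (A1 0), (A 0 + (B (-1) + c)) => -[x y]; rewrite inE => Uxy.
rewrite solutionE// AE BE; last by move: Uxy; rewrite /U /=; lra.
by rewrite /= /m; move: (A1 0) (A 0) (B (-1)) => a1 a0 b0; field.
Qed.

End Uniqueness.

(** * The solutions as a one-parameter family *)

Lemma is_solutionP (R : realType) (beta : nat) (g : R * R -> R) :
  (0 < beta)%N ->
  is_solution beta g <->
  exists C : R, forall s1 s2 : R, U (s1, s2) ->
    g (s1, s2) = C * (s1 ^+ 2 / 2) - (1 - C) * (2 / beta%:R) * s2.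
Proof.
move=> beta_gt0; set b : R := beta%:R; have b0 : 0 < b by rewrite ltr0n.
(* The axis s2 = 0 lies in the closure of [U], so the initial conditions can be read off the
   polynomial that extends [g]. *)
have axis (x : R) : 4 * (x, 0 : R).2 <= (x, 0 : R).1 ^+ 2.
  by rewrite /= mulr0 sqr_ge0.
split=> [[gC2 gS [g_cvg g0 dg0]]|[C gE]].
  have [c [d [e gE]]] := solution_quad R beta g beta_gt0 gC2 gS g_cvg.
  set a := _ - _ in gE.
  have ext p : 4 * p.2 <= p.1 ^+ 2 -> _ :=
    fun Up => ext_by_continuityE _ _ _ _ Up gE (continuous_quad _ _ _ _ _ p).
  have e0 : e = 0 by move: g0; rewrite (ext _ (axis 0))/= => <-; ring.
  have d0 : d = 0.
    have E : (fun x : R => ext_by_continuity g (x, 0))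
        = fun x => a * x ^+ 2 + d * x + 0.
      by apply/funext => x; rewrite (ext _ (axis x))/= e0; ring.
    rewrite E in dg0; have [_] := dg0.
    by have [_ ->] := is_derive_quad R a d 0 0; rewrite mulr0 add0r.
  (* The coefficient of s1^2 has to be C/2; a = 1/2 + b c/4 then gives c = -(1 - C) 2/b. *)
  exists (2 * a) => x y Uxy; rewrite gE ?inE// d0 e0 /a -/b /=.
  by field; rewrite gt_eqF.
pose f0 : R := - ((1 - C) * (2 / b)).
have gq : {in U, g =1 fun p => C / 2 * p.1 ^+ 2 + 0 * p.1 + f0 * p.2 + 0}.
  by move=> [x y]; rewrite inE => /gE -> /=; rewrite /f0 -/b; ring.
(* First [g], then both of its partial derivatives, to reach the second order. *)
have [gC1 g1E g2E] := quad_on_U _ _ _ _ _ _ gq.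
have [g1C1 g11E g12E] := quad_on_U _ _ _ _ _ _ g1E.
have [g2C1 g21E g22E] := quad_on_U _ _ _ _ _ _ g2E.
have ext p : 4 * p.2 <= p.1 ^+ 2 -> _ :=
  fun Up => ext_by_continuityE _ _ _ _ Up gq (continuous_quad _ _ _ _ _ p).
split=> //.
  move=> p Up; have {}Up := mem_set Up.
  rewrite g11E// g22E// g2E// g21E// /f0 -/b; split; last by ring.
  by field; rewrite gt_eqF.
split; last 2 first.
- by rewrite (ext _ (axis 0))/=; ring.
- have -> : (fun x : R => ext_by_continuity g (x, 0))
      = fun x => C / 2 * x ^+ 2 + 0 * x + 0.
    by apply/funext => x; rewrite (ext _ (axis x))/=; ring.
  by apply: is_derive_eq (is_derive_quad _ _ _ _ _) _; rewrite mulr0 add0r.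
- apply/cvg_ex; eexists.
  exact: (ext_by_continuity_cvg _ _ _ _ (axis 0) gq (continuous_quad _ _ _ _ _ _)).
Qed.

(** * Determinant and discriminant of Hermitian 2 x 2 matrices, whose entries need not commute *)

Lemma det_mx22 (S : nzRingType) (M : 'M[S]_2) :
  \det M = M 0 0 * M 1 1 - M 0 1 * M 1 0.
Proof.
have ord2 (i : 'I_2) : i = 0 \/ i = 1.
  by case: i => -[|[|//]] ?; [left|right]; apply: val_inj.
have neq01 : (0 : 'I_2) != 1 by [].
rewrite /determinant (bigD1 (1%g : {perm 'I_2}))//= (bigD1 (tperm 0 1))/=; last first.
  apply/eqP => /permP/(_ 0); rewrite tpermL perm1 => /eqP.
  by rewrite eq_sym (negPf neq01).
rewrite [X in _ + (_ + X)]big_pred0 => [|s].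
  rewrite addr0 odd_perm1 odd_tperm neq01 expr0 expr1 mul1r mulN1r.
  rewrite !big_ord_recl !big_ord0 !mulr1.
  have -> : lift ord0 ord0 = 1 :> 'I_2 by apply: val_inj.
  by rewrite !perm1 tpermL tpermR.
(* A permutation of two points is determined by its value at 0. *)
apply/negP => /andP[s1 st].
case: (ord2 (s 0)) => s0; [case/eqP: s1|case/eqP: st]; apply/permP => i.
  case: (ord2 i) => ->; rewrite perm1 //.
  case: (ord2 (s 1)) => // s10; move: neq01.
  by rewrite -(inj_eq (@perm_inj _ s)) s0 s10 eqxx.
case: (ord2 i) => ->; rewrite ?tpermL ?tpermR //.
case: (ord2 (s 1)) => // s11; move: neq01.
by rewrite -(inj_eq (@perm_inj _ s)) s0 s11 eqxx.
Qed.

(** With real diagonal a, d and off-diagonal squared norm n, (a + d)^2 - 4 (a d - n) = (a - d)^2 + 4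
    n. *)
Lemma hermitian2_discriminant (R : realType) (beta : nat)
    (theta : 'M[entry R beta]_2) :
  beta \in [:: 1; 2; 4]%N -> hermitian2 theta ->
  4 * sigma2 theta <= sigma1 theta ^+ 2.
Proof.
move=> hbeta /matrixP herm.
have discr (a d n m : R) : 0 <= n -> m = 4 * (a * d - n) -> m <= (a + d) ^+ 2.
  move=> n0 ->; rewrite -subr_ge0.
  have -> : (a + d) ^+ 2 - 4 * (a * d - n) = (a - d) ^+ 2 + 4 * n by ring.
  by rewrite addr_ge0 ?sqr_ge0 ?mulr_ge0.
(* Imaginary parts on the diagonal equal their own negatives. *)
have selfN (x : R) : - x = x -> x = 0 by lra.
have := herm 0 0; have := herm 1 1; have := herm 0 1; rewrite !mxE.
rewrite /sigma1 /sigma2 det_mx22 /mxtrace !big_ord_recl big_ord0 addr0.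
have -> : lift ord0 ord0 = 1 :> 'I_2 by apply: val_inj.
move: (theta 0 0) (theta 0 1) (theta 1 0) (theta 1 1).
move: hbeta; rewrite !inE => /or3P[] /eqP -> /=.
- by move=> a p q d -> _ _; apply: (discr _ _ (p ^+ 2)); [exact: sqr_ge0 | ring].
- move=> [a a'] [p p'] [q q'] [d d'] [<- <-] [/selfN ->] [/selfN ->] /=.
  by apply: (discr _ _ (q ^+ 2 + q' ^+ 2)); [rewrite addr_ge0 ?sqr_ge0 | ring].
- move=> [a a1 a2 a3] [p p1 p2 p3] [q q1 q2 q3] [d d1 d2 d3].
  move=> [<- <- <- <-] [/selfN -> /selfN -> /selfN ->].
  move=> [/selfN -> /selfN -> /selfN ->] /=.
  apply: (discr _ _ (q ^+ 2 + q1 ^+ 2 + q2 ^+ 2 + q3 ^+ 2)); last by ring.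
  by rewrite !addr_ge0 ?sqr_ge0.
Qed.

(** * The solutions of the system and the resulting function [L] *)

Theorem proposition5p6 (R : realType) (beta : nat)
    (hbeta : beta \in [:: 1; 2; 4]%N) :
  (forall g : R * R -> R,
     is_solution beta g <->
     exists C : R, forall s1 s2 : R, U (s1, s2) ->
       g (s1, s2) = C * (s1 ^+ 2 / 2) - (1 - C) * (2 / beta%:R) * s2) /\
  (forall (g : R * R -> R) (C : R),
     is_solution beta g ->
     (forall s1 s2 : R, U (s1, s2) ->
       g (s1, s2) = C * (s1 ^+ 2 / 2) - (1 - C) * (2 / beta%:R) * s2) ->
     forall L : 'M[entry R beta]_2 -> R,
       log_given_by L g ->
       forall theta : 'M[entry R beta]_2, hermitian2 theta ->
         L theta = expR (C * (sigma1 theta ^+ 2 / 2)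
                         - (1 - C) * (2 / beta%:R) * sigma2 theta)).
Proof.
split=> [g|g C _ gE L logL theta herm].
  by apply: is_solutionP; move: hbeta; rewrite !inE => /or3P[] /eqP ->.
have [L0 extL] := logL _ herm.
have gq : {in U, g =1 fun p => C / 2 * p.1 ^+ 2 + 0 * p.1
                               + - ((1 - C) * (2 / beta%:R)) * p.2 + 0}.
  by move=> [x y]; rewrite inE => /gE -> /=; ring.
have disc := hermitian2_discriminant R beta theta hbeta herm.
rewrite -[LHS]lnK ?posrE// -extL; congr expR.
(* A double eigenvalue puts the point on the boundary of [U], where the extension by continuity
   still equals the polynomial. *)
have -> := ext_by_continuityE _ _ _ (sigma1 theta, sigma2 theta) disc gq
  (continuous_quad _ _ _ _ _ _).
by rewrite /=; ring.
Qed.
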